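(* Let $Q$ be a tree network and $0<\alpha<2\mu$. Then any $E$-patrolling strategy intercepts any attack in the continuous patrolling game with attack duration $\alpha$ with probability at least $v^*=\alpha/(\mu+\lambda(E))$.
   Context: $Q$ is a tree: a finite connected acyclic network with no degree-two nodes, not a line segment. Arcs are open intervals of positive length. $\lambda$ is the length measure, $\mu=\lambda(Q)$, $d$ is the shortest-path metric, and regular points are interior points of arcs. The game is as follows. The Patroller picks a patrol $S:[0,\infty)\to Q$ with $d(S(t),S(t'))\le|t-t'|$. The Attacker picks $x\in Q$ and $\tau\ge0$, and the attack is intercepted iff $x\in S([\tau,\tau+\alpha])$. For a regular point $x$, $Q\setminus\{x\}$ has two components $Q_1(x),Q_2(x)$. The extremity set $E$ is the set of regular points $x$ with $\min_i\lambda(Q_i(x))<\alpha/2$. An $E$-patrolling strategy is the randomized periodic extension $t\mapsto S^E((t+\Delta)\bmod L)$, with $\Delta$ uniform on $[0,L]$, of a closed unit speed path $S^E:[0,L]\to Q$ with $L=2(\mu+\lambda(E))$ that visits every point $x\in Q$ at two times in $[0,L)$ whose distance modulo $L$ is at least $\alpha$. Such paths exist. *)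

(* Defs.v *)
From HB Require Import structures.
From mathcomp Require Import all_boot all_order all_algebra.
From mathcomp Require Import all_classical all_reals all_analysis.
From mathcomp Require Import lra.

Set Implicit Arguments.
Unset Strict Implicit.
Unset Printing Implicit Defensive.

Import Order.TTheory GRing.Theory Num.Theory.
Import numFieldNormedType.Exports.

Local Open Scope classical_set_scope.
Local Open Scope ring_scope.

(* Loops and parallel arcs are allowed here and are ruled out by [acyclic].
   The orientation src -> tgt only serves to coordinatize an arc. *)
Record network (R : realType) := Network {
  node : finType;
  arc : finType;
  src : arc -> node;
  tgt : arc -> node;
  len : arc -> R;
  len_gt0 : forall a, 0 < len a;
  node_inhabited : (0 < #|node|)%N;
  network_connected : forall u v : node,
    connect (fun u v => [exists a, ((src a == u) && (tgt a == v))
                                || ((src a == v) && (tgt a == u))]) u v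
}.

Section Tree.
Variables (R : realType) (Q : network R).

(* A dart is an arc with a direction of travel; (a, true) goes from src a to
   tgt a. *)
Definition dart := (arc Q * bool)%type.
Definition dsrc (p : dart) : node Q := if p.2 then src p.1 else tgt p.1.
Definition dtgt (p : dart) : node Q := if p.2 then tgt p.1 else src p.1.

(* A loop counts twice. *)
Definition degree (v : node Q) : nat := #|[set p : dart | dsrc p == v]|.

Definition acyclic : Prop :=
  forall c : seq dart,
    cycle (fun p q => dtgt p == dsrc q) c ->
    uniq [seq dsrc p | p <- c] -> uniq [seq p.1 | p <- c] -> c = [::].

(* Since no node has degree two, a tree is a line segment exactly when it
   consists of a single arc and its two endpoints. *)
Record tree : Prop := Tree {
  tree_acyclic : acyclic;
  tree_degree : forall v, degree v != 2%N;
  tree_not_segment : #|arc Q| != 1%N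
}.

End Tree.

(* A point is a node or a pair (a, t) with 0 < t < len a, on the open arc a. *)
Definition point (R : realType) (Q : network R) : Type :=
  (node Q + {p : arc Q * R | (0 < p.2) && (p.2 < len p.1)})%type.
Coercion point : network >-> Sortclass.

HB.instance Definition _ (R : realType) (Q : network R) := Choice.on (point Q).

Section Metric.
Variables (R : realType) (Q : network R).
Implicit Types (a : arc Q) (x y z : Q).

Definition regular x : Prop := if x is inr _ then True else False.

(* On [0, len a], the parametrization of the closed arc a by arc length. *)
Definition chart a (t : R) : Q :=
  match insub (a, t) with
  | Some p => inr p
  | None => inl (if t <= 0 then src a else tgt a)
  end.

(* A walk is a list of segments (a, s, t), travelling along the closed arc a
   from coordinate s to coordinate t. *)
Fixpoint walk x (w : seq (arc Q * R * R)) y : Prop :=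
  match w with
  | [::] => x = y
  | (a, s, t) :: w' => [/\ 0 <= s <= len a, 0 <= t <= len a,
                           chart a s = x & walk (chart a t) w' y]
  end.

Definition walk_length (w : seq (arc Q * R * R)) : R :=
  \sum_(p <- w) `|p.1.2 - p.2|.

Definition path_dist x y : R :=
  inf [set walk_length w | w in [set w | walk x w y]].

Lemma chart0 a : chart a 0 = inl (src a).
Proof. by rewrite /chart insubF ?lexx //= ltxx. Qed.

Lemma chart_len a : chart a (len a) = inl (tgt a).
Proof. by rewrite /chart insubF /= ?ltxx ?andbF // leNgt len_gt0. Qed.

Lemma chart_val (p : {p : arc Q * R | (0 < p.2) && (p.2 < len p.1)}) :
  chart (val p).1 (val p).2 = inr p.
Proof. by rewrite /chart -surjective_pairing valK. Qed.

Lemma chart_in a t (h : (0 < t) && (t < len a)) :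
  chart a t = inr (exist (fun p => (0 < p.2) && (p.2 < len p.1)) (a, t) h).
Proof. by rewrite /chart insubT. Qed.

Lemma walk_length_ge0 w : 0 <= walk_length w.
Proof. exact: sumr_ge0. Qed.

Lemma walk_cat x w1 y w2 z : walk x w1 y -> walk y w2 z -> walk x (w1 ++ w2) z.
Proof.
elim: w1 x => [x /= -> //|[[a s] t] w1 IH x /= [hs ht hx hw] hz].
by split=> //; exact: IH.
Qed.

Definition rev_walk (w : seq (arc Q * R * R)) :=
  rev [seq (p.1.1, p.2, p.1.2) | p <- w].

Lemma walk_rev x w y : walk x w y -> walk y (rev_walk w) x.
Proof.
elim: w x => [x /= -> //|[[a s] t] w IH x /= [hs ht hx hw]].
rewrite /rev_walk /= rev_cons -cats1; apply: walk_cat (IH _ hw) _.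
by split.
Qed.

Lemma walk_length_rev w : walk_length (rev_walk w) = walk_length w.
Proof.
rewrite /walk_length /rev_walk (perm_big _ (permEl (perm_rev _))) /= big_map.
by apply: eq_bigr => p _; rewrite distrC.
Qed.

Lemma walk_node u v : exists w, walk (inl u) w (inl v).
Proof.
have /connectP[p hp ->] := network_connected u v.
elim: p u hp => [u _|u' p IH u /= /andP[/existsP[a ha] hp]].
  by exists [::].
have [w hw] := IH _ hp.
have l0 := len_gt0 a.
case/orP: ha => /andP[/eqP hs /eqP ht].
- exists ((a, 0, len a) :: w) => /=; rewrite !lexx ltW //.
  by rewrite chart0 chart_len hs ht; split.
- exists ((a, len a, 0) :: w) => /=; rewrite !lexx ltW //.
  by rewrite chart0 chart_len hs ht; split.
Qed.

Lemma walk_to_node x : exists u w, walk x w (inl u).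
Proof.
case: x => [u|p]; first by exists u, [::].
have /andP[h0 h1] := valP p.
exists (src (val p).1), [:: ((val p).1, (val p).2, 0)] => /=.
by rewrite chart_val chart0 lexx !ltW // (lt_trans h0 h1).
Qed.

Lemma walk_exists x y : exists w, walk x w y.
Proof.
have [u [w1 h1]] := walk_to_node x.
have [v [w2 h2]] := walk_to_node y.
have [w h] := walk_node u v.
exists (w1 ++ (w ++ rev_walk w2)).
exact: walk_cat h1 (walk_cat h (walk_rev h2)).
Qed.

Lemma has_inf_walk x y :
  has_inf [set walk_length w | w in [set w | walk x w y]].
Proof.
split; last by exists 0 => _ [w _ <-]; exact: walk_length_ge0.
by have [w h] := walk_exists x y; exists (walk_length w), w.
Qed.

Lemma path_dist_le x w y : walk x w y -> path_dist x y <= walk_length w.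
Proof. by move=> h; apply: ge_inf; [exact: (has_inf_walk x y).2|exists w]. Qed.

Lemma path_dist_ge x y c :
  (forall w, walk x w y -> c <= walk_length w) -> c <= path_dist x y.
Proof.
move=> h; apply: lb_le_inf; first exact: (has_inf_walk x y).1.
by move=> _ [w hw <-]; exact: h.
Qed.

Lemma path_distxx x : path_dist x x = 0.
Proof.
apply/eqP; rewrite eq_le; apply/andP; split.
  have -> : 0 = walk_length [::] by rewrite /walk_length big_nil.
  exact: path_dist_le.
by apply: path_dist_ge => w _; exact: walk_length_ge0.
Qed.

Lemma path_dist_sym x y : path_dist x y = path_dist y x.
Proof.
wlog suff : x y / path_dist x y <= path_dist y x.
  by move=> h; apply/eqP; rewrite eq_le !h.
apply: path_dist_ge => w hw; rewrite -walk_length_rev.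
exact: path_dist_le (walk_rev hw).
Qed.

Lemma path_dist_triangle y x z :
  path_dist x z <= path_dist x y + path_dist y z.
Proof.
rewrite -lerBlDr; apply: path_dist_ge => w1 h1.
rewrite lerBlDr addrC -lerBlDr; apply: path_dist_ge => w2 h2.
rewrite lerBlDr addrC; have := path_dist_le (walk_cat h1 h2).
by rewrite /walk_length big_cat.
Qed.

Lemma path_dist_lip (f : Q -> R) :
  (forall a s t, 0 <= s <= len a -> 0 <= t <= len a ->
     f (chart a t) - f (chart a s) <= `|s - t|) ->
  forall x y, f y - f x <= path_dist x y.
Proof.
move=> hf x y; apply: path_dist_ge => w.
elim: w x => [x /= ->|[[a s] t] w IH x /= [hs ht <- hw]].
  by rewrite /walk_length big_nil subrr.
rewrite /walk_length big_cons /=.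
by have := IH _ hw; have := hf _ _ _ hs ht; rewrite /walk_length; lra.
Qed.

Lemma chart_cases a t : 0 <= t <= len a ->
  [\/ t = 0, t = len a | (0 < t) && (t < len a)].
Proof.
move=> /andP[]; rewrite le_eqVlt => /orP[/eqP <-|t0]; first by constructor 1.
rewrite le_eqVlt => /orP[/eqP <-|t1]; first by constructor 2.
by constructor 3; rewrite t0.
Qed.

Lemma path_dist_separated x y : path_dist x y = 0 -> x = y.
Proof.
move=> d0; apply: contrapT => xy.
suff [f [h [hfh hh fx fy]]] : exists f : Q -> R, exists h : arc Q -> R -> R,
    [/\ forall a t, 0 <= t <= len a -> f (chart a t) = h a t,
        forall a s t, h a t - h a s <= `|s - t|, f x = 0 & 0 < f y].
  have /path_dist_lip/(_ x y) : forall a s t, 0 <= s <= len a ->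
      0 <= t <= len a -> f (chart a t) - f (chart a s) <= `|s - t|.
    by move=> a s t hs ht; rewrite !hfh.
  by rewrite d0 fx subr0 leNgt fy.
case: x xy {d0} => [v|[[a0 c] /= hc]] xy.
- pose e := \big[Order.min/1]_(a : arc Q) len a.
  have e0 : 0 < e.
    by apply: lt_bigmin => // a _; exact: len_gt0.
  have el a : e <= len a by exact: bigmin_le_cond.
  pose h a t := Num.min e (Num.min (if src a == v then t else e)
                               (if tgt a == v then len a - t else e)).
  exists (fun z => match z with inl w => if w == v then 0 else e
                   | inr p => h (val p).1 (val p).2 end), h; split.
  + move=> a t /chart_cases[->|->|ht].
    * rewrite chart0 /h; have := el a; case: ifP => _; case: ifP => _;
      rewrite /Num.min; do ?case: ifP; lra.
    * rewrite chart_len /h; have := el a; case: ifP => _; case: ifP => _;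
      rewrite /Num.min; do ?case: ifP; lra.
    * by rewrite chart_in.
  + move=> a s t; rewrite /h; have := ler_norm (s - t).
    have := ler_norm (t - s); rewrite distrC.
    case: ifP => _; case: ifP => _; rewrite /Num.min; do ?case: ifP; lra.
  + by rewrite eqxx.
  + case: y xy => [w|[[a t] /= ht]] xy.
      by case: eqP => // wv; case: xy; rewrite wv.
    case/andP: (ht) => t0 t1.
    rewrite /h; case: ifP => _; case: ifP => _; rewrite /Num.min;
    do ?case: ifP; lra.
- case/andP: (hc) => c0 c1.
  pose e := Num.min c (len a0 - c).
  have [e0 ec el] : [/\ 0 < e, e <= c & e <= len a0 - c].
    by rewrite /e /Num.min; case: ifP; split; lra.
  pose h a t := if a == a0 then Num.min `|t - c| e else e.
  exists (fun z => match z with inl w => e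
                   | inr p => h (val p).1 (val p).2 end), h; split.
  + move=> a t /chart_cases[->|->|ht]; last by rewrite chart_in.
    * rewrite chart0 /h; case: eqP => // _.
      by rewrite sub0r normrN gtr0_norm // min_r.
    * rewrite chart_len /h; case: eqP => // ->.
      by rewrite gtr0_norm ?subr_gt0 // min_r.
  + move=> a s t; rewrite /h; case: eqP => _; last by rewrite subrr.
    have := ler_distD s t c; rewrite (distrC t s) => ?.
    have := normr_ge0 (s - t).
    rewrite /Num.min; do ?case: ifP; lra.
  + by rewrite /= /h eqxx subrr normr0 min_l // ltW.
  + case: y xy => [w //|[[a t] /= ht]] xy.
    rewrite /h; case: eqP => // aa; rewrite lt_min e0 andbT normr_gt0 subr_eq0.
    apply/eqP => tc; apply: xy; subst a t; congr inr; exact: val_inj.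
Qed.

End Metric.

HB.instance Definition _ (R : realType) (Q : network R) :=
  @isMetric.Build R (point Q) (@path_dist R Q) (@path_distxx R Q)
    (@path_dist_separated R Q) (@path_dist_sym R Q) (@path_dist_triangle R Q).

Section Game.
Variables (R : realType) (Q : network R).
Implicit Types (B : set Q) (S SE : R -> Q) (x : Q) (alpha L : R).

(* Each summand is finite, being the measure of a subset of [0, len a]. *)
Definition lambda B : R :=
  \sum_(a : arc Q)
     fine (@lebesgue_measure R (`[0, len a] `&` (@chart R Q a) @^-1` B)).

Definition mu : R := lambda setT.

(* The components of Q minus x are the connected components of its points. *)
Definition extremity alpha : set Q :=
  [set x | regular x /\
     exists2 y : Q, y != x & lambda (connected_component (~` [set x]) y)
                             < alpha / 2].

(* Unit speed means speed at most one, for patrols and for tours alike. *)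
Definition unit_speed (I : set R) S : Prop :=
  forall t t', I t -> I t' -> mdist (S t) (S t') <= `|t - t'|.

Definition patrol S : Prop := unit_speed `[0, +oo[ S.

Definition intercepts alpha S x (tau : R) : Prop :=
  (S @` `[tau, tau + alpha]) x.

Definition rmod (t L : R) : R := t - (Num.floor (t / L))%:~R * L.

(* For s and t in [0, L). *)
Definition dist_mod L (s t : R) : R := Num.min `|s - t| (L - `|s - t|).

Record E_tour alpha L SE : Prop := ETour {
  tour_length : L = 2 * (mu + lambda (extremity alpha));
  tour_closed : SE 0 = SE L;
  tour_unit_speed : unit_speed `[0, L] SE;
  tour_twice : forall x, exists s t,
    [/\ `[0, L[%classic s, `[0, L[%classic t,
        SE s = x, SE t = x & alpha <= dist_mod L s t]
}.

Definition E_patrol L SE (D t : R) : Q := SE (rmod (t + D) L).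

Lemma E_tour_gt0 alpha L SE : E_tour alpha L SE -> 0 < L.
Proof.
move=> [_ _ _ h]; have /card_gt0P[v _] := node_inhabited Q.
have [s [t [+ _ _ _ _]]] := h (inl v).
by rewrite /= in_itv /= => /andP[]; exact: le_lt_trans.
Qed.

Lemma rmod_itv t L : 0 < L -> 0 <= rmod t L < L.
Proof.
move=> L0; rewrite /rmod; have := floor_itv (t / L).
rewrite ler_pdivlMr // ltr_pdivrMr // => /andP[h1 h2].
move: h2; rewrite intrD mulrDl mul1r; lra.
Qed.

Lemma E_patrol_patrol alpha L SE D :
  E_tour alpha L SE -> patrol (E_patrol L SE D).
Proof.
move=> hE; have L0 := E_tour_gt0 hE; case: hE => _ hc hu _.
suff H s t : s <= t -> mdist (SE (rmod s L)) (SE (rmod t L)) <= t - s.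
  move=> t t' _ _; rewrite /E_patrol; case: (leP t t') => tt.
    by apply: le_trans (H _ _ _) _; rewrite ?lerD2r // ler0_norm; lra.
  by rewrite metric_sym; apply: le_trans (H _ _ _) _;
     rewrite ?lerD2r ?gtr0_norm; lra.
move=> st; have /andP[s0 s1] := rmod_itv s L0.
have /andP[t0 t1] := rmod_itv t L0.
have : Num.floor (s / L) <= Num.floor (t / L).
  by apply: le_floor; rewrite ler_pM2r // invr_gt0.
have Is : `[0, L]%classic (rmod s L) by rewrite /= in_itv /= s0 ltW.
have It : `[0, L]%classic (rmod t L) by rewrite /= in_itv /= t0 ltW.
have I0 : `[0, L]%classic 0 by rewrite /= in_itv /= lexx ltW.
have IL : `[0, L]%classic L by rewrite /= in_itv /= lexx ltW.
rewrite le_eqVlt => /orP[/eqP e|e].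
  apply: le_trans (hu _ _ Is It) _.
  by rewrite /rmod e ler0_norm; lra.
have h1 : mdist (SE (rmod s L)) (SE L) <= L - rmod s L.
  by apply: le_trans (hu _ _ Is IL) _; rewrite ler0_norm; lra.
have h2 : mdist (SE L) (SE (rmod t L)) <= rmod t L.
  by rewrite -hc; apply: le_trans (hu _ _ I0 It) _; rewrite ler0_norm; lra.
apply: le_trans (metric_triangle _ (SE L) _) _.
apply: le_trans (lerD h1 h2) _; rewrite /rmod.
have : (Num.floor (s / L))%:~R * L + L <= (Num.floor (t / L))%:~R * L.
  rewrite -[X in _ + X <= _]mul1r -mulrDl ler_pM2r // -[1]/(1%:~R) -intrD.
  by rewrite ler_int lezD1.
lra.
Qed.

(* The event over which the random shift D is uniform on [0, L]. *)
Definition interception alpha L SE x (tau : R) : set R :=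
  [set D | intercepts alpha (E_patrol L SE D) x tau].

End Game.

(* Main.v *)
(* The tour visits x at two times s, t that are at least alpha apart modulo L.
   The attack is intercepted as soon as the shift puts one of these visits in
   the window [tau, tau + alpha], that is, when D lies modulo L in one of two
   intervals of length alpha; these do not overlap, so the probability is at
   least 2 alpha / L = alpha / (mu + lambda E). Interception is measurable
   because it is a closed condition on D: the distance from the patrol to x,
   when nonzero throughout the compact window, stays so under small shifts. *)
Require Import Defs.
From HB Require Import structures.
From mathcomp Require Import all_boot all_order all_algebra.
From mathcomp Require Import all_classical all_reals all_analysis.
From mathcomp Require Import measurable_realfun lra.

Import Order.TTheory GRing.Theory Num.Theory.
Import numFieldNormedType.Exports.

Local Open Scope classical_set_scope.
Local Open Scope ring_scope.

Lemma closed_window_hits {R : realType} {M : metricType R} (g : R -> M)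
    (glip : forall s t, mdist (g s) (g t) <= `|s - t|) (a b : R) (x : M) :
  a <= b -> closed [set D | exists2 u, a <= u <= b & g (u + D) = x].
Proof.
move=> ab; rewrite -openC openE => D /= nD.
pose f u := mdist (g (u + D)) x.
have flip s t : `|f s - f t| <= `|s - t|.
  rewrite /f ler_norml; have := glip (s + D) (t + D).
  have := metric_triangle (g (s + D)) (g (t + D)) x.
  have := metric_triangle (g (t + D)) (g (s + D)) x.
  rewrite (metric_sym (g (t + D)) (g (s + D))).
  have -> : s + D - (t + D) = s - t by lra.
  by move=> *; apply/andP; split; lra.
have fcont : continuous f.
  move=> t; apply/cvgrPdist_lt => e e0.
  apply/nbhs_ballP; exists e => //= s; exact: le_lt_trans (flip _ _).
have [c cab cmin] := EVT_min ab (continuous_subspaceT fcont).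
have m0 : 0 < f c.
  rewrite mdist_gt0; apply/eqP => gc; apply: nD; exists c => //.
(* The least distance [f c] to [x] over the window serves as radius: a hit [g (u + D') = x] with
   [D'] in this ball would give [f u <= |D - D'| < f c]. *)
rewrite /interior /=; apply/nbhs_ballP; exists (f c) => //= D' DD' [u uab gu].
have uin : u \in `[a, b] by rewrite in_itv.
have := cmin u uin; rewrite leNgt => /negP; apply.
rewrite {1}/f -gu; apply: le_lt_trans (glip _ _) _.
have -> : u + D - (u + D') = D - D' by lra.
exact: DD'.
Qed.

Lemma uniform_prob_itv {R : realType} {L : R} (L0 : 0 < L) (a b : R) :
  0 <= a -> a <= b -> b <= L -> uniform_prob L0 `[a, b[ = ((b - a) / L)%:E.
Proof.
move=> a0 ab bL; rewrite /uniform_prob (eq_integral (fun=> (L^-1)%:E)).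
  rewrite integral_cst//= lebesgue_measure_itv/= lte_fin.
  case: ltP => ab'; first by rewrite -EFinD -EFinM mulrC.
  have -> : b - a = 0 by lra.
  by rewrite mule0 mul0r.
move=> D; rewrite inE /= in_itv /= => /andP[aD Db].
by rewrite /uniform_pdf subr0 (le_trans a0 aD) (le_trans (ltW Db) bL).
Qed.

Lemma periodic_shift {R : realType} (A : set R) (L : R) :
  (forall D, A (D + L) <-> A D) -> forall (k : int) D, A (D + k%:~R * L) <-> A D.
Proof.
move=> per; have pos (n : nat) D : A (D + n%:R * L) <-> A D.
  elim: n D => [|n IH] D; first by rewrite mul0r addr0.
  by rewrite -natr1 mulrDl mul1r addrA per.
case=> n D; first exact: pos.
rewrite NegzE mulrNz -(pos n.+1).
by have -> : D + - (n.+1%:~R) * L + n.+1%:R * L = D by rewrite -pmulrn; lra.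
Qed.

(** Since [p + l <= q < L], only the second interval can run past [L]. Periodicity moves its
    overhang down to 0, and [q <= p + L - l] makes the moved piece end no later than [p], so
    disjoint pieces of total length [2 * l] lie in [[0, L]]. *)
Lemma uniform_prob_periodic_ge {R : realType} {L : R} (L0 : 0 < L) (A : set R)
    (p q l : R) :
  measurable A -> (forall D, A (D + L) <-> A D) ->
  0 <= l -> 0 <= p -> p + l <= q -> q <= p + L - l -> q < L ->
  `[p, p + l] `<=` A -> `[q, q + l] `<=` A ->
  ((2 * l / L)%:E <= uniform_prob L0 A)%E.
Proof.
move=> mA per l0 p0 pq qp qL pA qA.
(* Modulo L, the interval [q, q + l[ becomes [q, v[ together with [0, u[. *)
pose u := Num.max 0 (q + l - L); pose v := Num.min L (q + l).
have [u0 up v1 qv [vL uv]] : [/\ 0 <= u, u <= p, v <= q + l, q <= v & v <= L /\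
    u + l + (v - q) = 2 * l].
  rewrite /u /v /Num.max /Num.min.
  by do 2 case: ifP => ?; split; lra.
(* Half-open pieces stay disjoint even when they touch, so their probabilities add up. *)
pose B := `[0, u[%classic `|` `[p, p + l[ `|` `[q, v[.
have BA : B `<=` A.
  move=> D [[]|] /=; rewrite in_itv /= => /andP[h1 h2].
  - apply/per; apply: qA; rewrite /= in_itv /=.
    by move: h2; rewrite lt_max => /orP[|]; lra.
  - by apply: pA; rewrite /= in_itv /= h1 ltW.
  - by apply: qA; rewrite /= in_itv /= h1 /=; lra.
apply: (@le_trans _ _ (uniform_prob L0 B)).
  rewrite /B !measureU //=.
  - have [uL pL q0 pl] : [/\ u <= L, p + l <= L, 0 <= q & p <= p + l].
      by split; lra.
    rewrite !uniform_prob_itv // -!EFinD lee_fin -!mulrDl.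
    by rewrite ler_pM2r ?invr_gt0 //; lra.
  - rewrite -subset0 => D [] /=; rewrite !in_itv /=; lra.
  - exact: measurableU.
  - rewrite -subset0 => D [[]] /=; rewrite !in_itv /=; lra.
by apply: le_measure => //; rewrite inE //; do ?apply: measurableU.
Qed.

Lemma rmodDL {R : realType} (t L : R) : 0 < L -> rmod (t + L) L = rmod t L.
Proof.
move=> L0; rewrite /rmod mulrDl divff ?gt_eqF // floorDrz ?floor1 ?rpred1 //.
by rewrite intrD mulrDl mul1r; lra.
Qed.

Lemma rmod_id {R : realType} (t L : R) : 0 <= t < L -> rmod t L = t.
Proof.
move=> /andP[t0 tL]; have L0 : 0 < L by lra.
rewrite /rmod (@floor_def _ _ 0) ?mul0r ?subr0 //.
by rewrite add0r divr_ge0 ?(ltW L0) //= ltr_pdivrMr // mul1r.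
Qed.

(** A patrol is constrained at nonnegative times only, while shifts range over all reals. Taking the
    smaller of [s] and [t] as the shift reduces to nonnegative times. *)
Lemma E_patrol_lip {R : realType} {Q : network R} (alpha L : R) (SE : R -> Q) :
  E_tour alpha L SE ->
  forall s t, mdist (SE (rmod s L)) (SE (rmod t L)) <= `|s - t|.
Proof.
move=> hE s t; pose m := Num.min s t.
have [ms mt] : m <= s /\ m <= t by rewrite /m /Num.min; case: ifP; lra.
have := @E_patrol_patrol _ _ _ _ _ m hE (s - m) (t - m).
rewrite /E_patrol !subrK /= !in_itv /= !andbT !subr_ge0.
have -> : s - m - (t - m) = s - t by lra.
exact.
Qed.

Theorem theorem7 (R : realType) (Q : network R) (treeQ : tree Q)
    (alpha : R) (alpha_gt0 : 0 < alpha) (alpha_lt : alpha < 2 * mu Q)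
    (L : R) (SE : R -> Q) (tourSE : E_tour alpha L SE)
    (x : Q) (tau : R) (tau_ge0 : 0 <= tau) :
  measurable (interception alpha L SE x tau) /\
  ((alpha / (mu Q + lambda (extremity (Q := Q) alpha)))%:E
     <= uniform_prob (E_tour_gt0 tourSE) (interception alpha L SE x tau))%E.
Proof.
have L0 := E_tour_gt0 tourSE.
have IE : interception alpha L SE x tau =
    [set D | exists2 u, tau <= u <= tau + alpha & SE (rmod (u + D) L) = x].
  by apply/seteqP; split => D [u]; rewrite /= ?in_itv /= => ? ?; exists u;
     rewrite //= in_itv.
have mI : measurable (interception alpha L SE x tau).
  apply: closed_measurable; rewrite IE.
  apply: (@closed_window_hits R Q (fun w => SE (rmod w L))); last lra.
  exact: E_patrol_lip tourSE.
split=> //.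
have per D : interception alpha L SE x tau (D + L) <->
             interception alpha L SE x tau D.
  by rewrite IE; split => -[u hu] h; exists u => //;
     rewrite ?addrA ?rmodDL // -(rmodDL _ _ L0) -addrA.
(* The visit at time [s] falls in the window when [u + D] equals [s] modulo [L] for some [u] in
   [[tau, tau + alpha]]; [k] selects the translate of the resulting interval of shifts. *)
have hit s (k : int) : 0 <= s < L -> SE s = x ->
    let c := s - tau - alpha + k%:~R * L in
    `[c, c + alpha] `<=` interception alpha L SE x tau.
  move=> sL sx c D; rewrite /= in_itv /= => hD.
  rewrite -(subrK (k%:~R * L) D); apply/(periodic_shift _ _ per).
  rewrite IE /=; exists (s - (D - k%:~R * L)).
    by move: hD; rewrite /c => /andP[? ?]; apply/andP; split; lra.
  by rewrite subrK rmod_id.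
have -> : alpha / (mu Q + lambda (extremity (Q := Q) alpha)) = 2 * alpha / L.
  have := tour_length tourSE; have := L0; move=> + LE; rewrite LE => L0'.
  by rewrite -mulf_div divff ?mul1r // pnatr_eq0.
have [s [t []]] := tour_twice tourSE x.
rewrite /= !in_itv /= => sL tL sx tx.
wlog st : s t sL tL sx tx / s <= t => [H|].
  case: (leP s t) => [|/ltW] st; first exact: H.
  by rewrite /dist_mod distrC; exact: H.
rewrite /dist_mod le_min ler0_norm; last lra.
move=> /andP[d1 d2].
have := rmod_itv (s - tau - alpha) L0; set c := s - tau - alpha.
(* This translate brings the left end of the interval for [s] into [[0, L)]. *)
pose k := - Num.floor (c / L).
have -> : rmod c L = c + k%:~R * L by rewrite /rmod /k mulrNz mulNr.
set p := c + _ => /andP[p0 pL].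
have hp := hit s k sL sx.
case: (ltP (p + (t - s)) L) => hq.
- have hq' := hit t k tL tx.
  apply: (uniform_prob_periodic_ge _ _ _ _ _ mI per _ p0 _ _ hq) => //; try lra.
  suff -> : p + (t - s) = t - tau - alpha + k%:~R * L by [].
  by rewrite /p /c; lra.
(* Here the interval for [t] would start at or after [L], so it is taken one period earlier. It then
   precedes the one for [s]: the two intervals swap roles, and so do the gap bounds [d1] and
   [d2]. *)
- have hq' := hit t (k - 1) tL tx.
  have E : t - tau - alpha + (k - 1)%:~R * L = p + (t - s) - L.
    by rewrite /p /c intrB; lra.
  rewrite /= E in hq'.
  by apply: (uniform_prob_periodic_ge _ _ _ _ _ mI per _ _ _ _ pL hq' hp); lra.
Qed.
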